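(* Let $G$ be a finite group and let $H$ be an abelian subgroup of $G$. Then for every $\varphi\in\widehat{G}$, $$\deg\varphi\le [G:H].$$
   Context: $\widehat{G}$ is a complete set of inequivalent irreducible representations of $G$ over $\mathbb{C}$, and $\deg\varphi$ is the dimension of the representation $\varphi$. $[G:H]$ is the index of $H$ in $G$. *)

(* Defs.v *)
From HB Require Import structures.
From mathcomp Require Import all_boot all_order all_fingroup all_algebra.
From mathcomp Require Import mxrepresentation reals.
From mathcomp Require Import complex.

Set Implicit Arguments.
Unset Strict Implicit.
Unset Printing Implicit Defensive.

(* Main.v *)
(** Restricted to the abelian group [H], the representation has a common
    eigenline [M].  Since [M] is [H]-stable, [M *m phi y] only depends on the
    coset [H y], so the sum of its at most [G : H] translates is [G]-stable and
    non-zero, hence is the whole space by irreducibility. *)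
Require Import Defs.
From HB Require Import structures.
From mathcomp Require Import all_boot all_order all_fingroup all_algebra.
From mathcomp Require Import mxrepresentation reals.
From mathcomp Require Import complex.

Set Implicit Arguments.
Unset Strict Implicit.
Unset Printing Implicit Defensive.

(** Leaving the rank of [M] free lets the translate argument run over any field; the theorem applies
    it at rank one. *)
Lemma mx_irr_degree_le_index_rank (F : fieldType) (gT : finGroupType)
    (G H : {group gT}) (sHG : H \subset G) (n : nat)
    (rG : mx_representation F G n) (M : 'M[F]_n) :
  mx_irreducible rG -> mxmodule (subg_repr rG sHG) M -> M != 0%R ->
  n <= #|G : H|%g * \rank M.
Proof.
move=> /mx_irrP[_ irrG] /mxmoduleP modM nzM.
pose S := (\sum_(C in rcosets H G) <<(M *m rG (repr C))%R>>)%MS.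
have sMS y : y \in G -> ((M *m rG y)%R <= S)%MS.
  move=> Gy; have HyC : (H :* y)%g \in rcosets H G.
    by apply/rcosetsP; exists y; rewrite ?rcosetE.
  apply: (sumsmx_sup (H :* y)%g) => //; rewrite genmxE.
  (* The chosen representative is [k * y] with [k] in [H], so it suffices that [M] lies in
     [M *m rG k]; this follows from stability under the inverse of [k]. *)
  case: repr_rcosetP => k Hk; have Gk := subsetP sHG k Hk.
  rewrite repr_mxM // mulmxA submxMr // -{1}(repr_mxKV rG Gk M) submxMr //.
  by rewrite modM ?groupV.
have Grepr C : C \in rcosets H G -> repr C \in G.
  case/rcosetsP=> y Gy ->.
  by case: repr_rcosetP => k Hk; rewrite groupM // (subsetP sHG).
have modS : mxmodule rG S.
  apply/mxmoduleP=> x Gx; rewrite (sumsmxMr_gen _ _ (rG x)).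
  apply/sumsmx_subP=> C /Grepr Gr; rewrite genmxE.
  by rewrite (eqmxMr _ (genmxE _)) -mulmxA -repr_mxM // sMS ?groupM.
have nzS : S != 0%R.
  (* The translate by [1] is [M] itself. *)
  apply: contraNneq nzM => S0; rewrite -submx0 -S0.
  by rewrite -[M]mulmx1 -(repr_mx1 rG) sMS.
(* [S] has full rank [n]; the bound becomes a constant sum over the cosets, compared term by
   term. *)
have /eqP {1}<- := irrG S modS nzS; rewrite -sum_nat_const.
apply: leq_trans (mxrank_sum_leqif _) _ => /=.
by apply: leq_sum => C _; rewrite genmxE mxrankM_maxl.
Qed.

Theorem corollary7 (R : realType) (gT : finGroupType) (G H : {group gT})
    (sHG : H \subset G) (abH : abelian H)
    (n : nat) (phi : mx_representation (complex R) G n)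
    (irr_phi : mx_irreducible phi) :
  n <= #|G : H|%g.
Proof.
have [_ nz1 _] := irr_phi.
(* The eigenline arises as a simple [H]-submodule of the whole space. *)
have [M simM _] := dec_mxsimple_exists (mxmodule1 (subg_repr phi sHG)) nz1.
have [modM nzM _] := simM.
have := mx_irr_degree_le_index_rank irr_phi modM nzM.
have splitH : group_splitting_field (complex R) H.
  exact: group_closure_closed_field.
by rewrite (mxsimple_abelian_linear splitH abH simM) muln1.
Qed.
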